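(* Let $f,g\in\mathbb{R}[x_0,\dots,x_n]$ be positive definite forms of positive degree. Then $fg^m$ is a sum of squares of forms in $\mathbb{R}[x_0,\dots,x_n]$ for all sufficiently large integers $m\ge 0$.
   Context: A form is a homogeneous polynomial. A form $f\in\mathbb{R}[x_0,\dots,x_n]$ is positive definite if $f(\xi)>0$ for all $\xi\in\mathbb{R}^{n+1}\setminus\{(0,\dots,0)\}$. *)

(* Defs.v *)
From HB Require Import structures.
From mathcomp Require Import all_boot all_order all_algebra.
From mathcomp Require Import mpoly.
From mathcomp Require Import reals.

Set Implicit Arguments.
Unset Strict Implicit.
Unset Printing Implicit Defensive.

Import Order.TTheory GRing.Theory Num.Theory.
Local Open Scope ring_scope.

(* The zero polynomial is a form, and is homogeneous of every degree. *)
Definition is_form (R : realType) (k : nat) (p : {mpoly R[k]}) : Prop :=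
  exists d : nat, p \is d.-homog.

Definition positive_definite (R : realType) (k : nat) (p : {mpoly R[k]}) : Prop :=
  forall x : 'rV[R]_k, x != 0 -> 0 < p.@[fun i => x 0 i].

(* The summands are forms, but are not required to share a degree. *)
Definition is_sos_of_forms (R : realType) (k : nat) (p : {mpoly R[k]}) : Prop :=
  exists s : seq {mpoly R[k]},
    (forall h, h \in s -> is_form h) /\ p = \sum_(h <- s) h ^+ 2.

(* Main.v *)
(* Write sigma for the sum of the squares of the variables.

   Reznick's theorem (the case g = sigma) is deduced from Polya's theorem. The
   squares y = (x_i +- x_j)^2 span the quadratic forms and add up to a multiple
   of sigma, so f (of even degree) is a form F in the y's. On the simplex, the
   points y(x) are cut out by finitely many relations, hence F plus a large
   multiple of the sum of the squares of these relations is positive there.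
   By Polya it gets nonnegative coefficients when multiplied by a power of
   the sum of the y's, and monomials in the y's are squares.

   For general g, put s = sigma^(deg f / 2), P = g^(2i) and let W be a multiple
   of a power of sigma of the same degree as P. Reznick's theorem shows that W
   can be chosen such that P (P - W) is a sum of squares, and (f - eps s) W too;
   moreover W - delta P and C s + f are sums of squares for some delta, C > 0.
   Thus w = W / P behaves like an element of [delta, 1], and expanding
   1 = (1 - (1 - w)^k) + (1 - w)^k, whose first summand is a multiple of w and
   whose second one is at most (1 - delta)^k, gives
     f = (f - eps s) (1 - (1 - w)^k) + (C s + f) (1 - w)^k
         + s (eps - (eps + C) (1 - w)^k).
   All three terms are sums of squares once k is large and denominators are
   cleared. *)
Require Import Defs.
From HB Require Import structures.
From mathcomp Require Import all_boot all_order all_algebra.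
From mathcomp Require Import mpoly.
From mathcomp Require Import reals.
From mathcomp Require Import boolp classical_sets topology normedtype derive.
From mathcomp Require Import zify ring lra.

Set Implicit Arguments.
Unset Strict Implicit.
Unset Printing Implicit Defensive.

Import Order.TTheory GRing.Theory Num.Theory.
Local Open Scope ring_scope.

(** * Minima of polynomials on compact sets *)

Section Compactness.
Import numFieldTopology.Exports numFieldNormedType.Exports.
Local Open Scope classical_set_scope.

Lemma meval_continuous (R : realType) (N : nat) (p : {mpoly R[N]}) :
  continuous (fun t : 'rV[R]_N => p.@[fun i => t 0 i]).
Proof.
have powX (i : 'I_N) (k : nat) : continuous (fun t : 'rV[R]_N => t 0 i ^+ k : R).
  elim: k => [|k IHk] x; first by under eq_fun do rewrite expr0; exact: cst_continuous.
  under eq_fun do rewrite exprS.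
  by apply: continuousM (IHk x); exact: coord_continuous.
have prodX (s : seq 'I_N) (e : 'I_N -> nat) :
    continuous (fun t : 'rV[R]_N => \prod_(i <- s) t 0 i ^+ e i : R).
  elim: s => [|i s IHs] x.
    by under eq_fun do rewrite big_nil; exact: cst_continuous.
  under eq_fun do rewrite big_cons.
  apply: continuousM (IHs x).
  exact: powX.
elim/mpolyind: p => [|c m p _ _ IHp] x.
  by under eq_fun do rewrite meval0; exact: cst_continuous.
under eq_fun do rewrite mevalD mevalZ mevalX.
apply: continuousD (IHp x).
by apply: continuousM; [exact: cst_continuous|exact: prodX].
Qed.

(** The box bound makes the closed set cut out by the inequalities compact. Equations will enter as
    two opposite inequalities. *)
Lemma mpoly_attains_min (R : realType) (N : nat) (I : Type)
    (h : I -> {mpoly R[N]}) (f : {mpoly R[N]}) :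
  let S (t : 'rV[R]_N) := (forall i, `|t 0 i| <= 1) /\
                 forall i, 0 <= (h i).@[fun j => t 0 j] in
  (exists t, S t) ->
  exists2 t, S t & forall s, S s -> f.@[fun i => t 0 i] <= f.@[fun i => s 0 i].
Proof.
move=> S S0.
have cS : compact [set t | S t].
  rewrite (_ : mkset _ = [set t : 'rV[R]_N | forall i, `[(-1), 1]%classic (t ord0 i)]
     `&` \bigcap_(i in setT) [set t | 0 <= (h i).@[fun j => t 0 j]]); last first.
    apply/seteqP; split => t /=.
      move=> [b c]; split => [i|i _]; last exact: c.
      by rewrite in_itv /= -ler_norml.
    move=> [b c]; split => [i|i]; last exact: c.
    by have := b i; rewrite in_itv /= -ler_norml.
  apply: compact_closedI.
    apply: (@rV_compact R N (fun=> `[(-1), 1]%classic)) => _.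
    exact: segment_compact.
  apply: closed_bigI => i _.
  apply: (closed_comp (f := fun t : 'rV[R]_N => (h i).@[fun j => t 0 j])
    (D := [set x : R | 0 <= x])).
    by move=> t _; exact: meval_continuous.
  exact: closed_ge.
have [||t St mt] := @EVT_min_rV R N (fun t => f.@[fun i => t 0 i]) [set t | S t] _ cS.
- by case: S0 => t St; exists t.
- by apply: continuous_subspaceT; exact: meval_continuous.
exists t; first by move: St; rewrite inE.
by move=> s Ss; apply: mt; rewrite inE.
Qed.
End Compactness.

(** * Polya's theorem *)

Section Words.
Variables (R : comNzRingType) (N : nat).
Implicit Types (p : {mpoly R[N]}).

Lemma mpolyX_seq (m : 'X_{1..N}) :
  exists2 s : seq 'I_N, size s = mdeg m & 'X_[R, m] = \prod_(i <- s) 'X_i.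
Proof.
exists (flatten [seq nseq (m i) i | i <- enum 'I_N]).
  rewrite size_flatten /shape -map_comp sumnE big_map mdegE big_enum /=.
  by apply: eq_bigr => i _; rewrite size_nseq.
rewrite mpolyXE_id big_flatten big_map big_enum /=.
by apply: eq_bigr => i _; rewrite big_nseq iter_mulr_1.
Qed.

Lemma dhomog_ind (P : {mpoly R[N]} -> Prop) (k : nat) :
  P 0 -> (forall p q, P p -> P q -> P (p + q)) ->
  (forall c (s : seq 'I_N), size s = k -> P (c *: \prod_(i <- s) 'X_i)) ->
  forall p, p \is k.-homog -> P p.
Proof.
move=> P0 PD PX p /dhomogP hp; rewrite [p]mpolyE big_seq.
apply: big_ind => // m /hp dm.
by have [s sz ->] := mpolyX_seq m; apply: PX; rewrite sz.
Qed.

(** Words are ordered, so that multinomial coefficients turn into counts of maps. *)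
Definition word (k : nat) (w : {ffun 'I_k -> 'I_N}) : {mpoly R[N]} :=
  \prod_i 'X_(w i).

Lemma dhomog_words (k : nat) p : p \is k.-homog ->
  exists a : {ffun 'I_k -> 'I_N} -> R, p = \sum_w a w *: word w.
Proof.
move: p; apply: dhomog_ind => [|p q [a ->] [b ->]|c s sz].
- by exists (fun=> 0); rewrite big1 // => w _; rewrite scale0r.
- exists (fun w => a w + b w); rewrite -big_split /=.
  by apply: eq_bigr => w _; rewrite scalerDl.
move: sz => /eqP sz; pose t := Tuple sz.
exists (fun w => if w == [ffun i => tnth t i] then c else 0).
rewrite (bigD1 [ffun i => tnth t i]) //= eqxx [X in _ + X]big1 ?addr0.
  congr (_ *: _); rewrite /word (big_tuple _ _ t).
  by apply: eq_bigr => i _; rewrite ffunE.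
by move=> w /negbTE ->; rewrite scale0r.
Qed.

(* Reading off [a] at [D] positions of a longer word, given by [io], instead of
   at the first [D] ones does not change the sum, since variables commute. *)
Lemma sum_words_inj (D M : nat) (a : {ffun 'I_D -> 'I_N} -> R)
    (io : {ffun 'I_D -> 'I_M}) : injective io ->
  \sum_(u : {ffun 'I_M -> 'I_N}) a [ffun i => u (io i)] *: word u =
  (\sum_i 'X_i) ^+ (M - D) * \sum_w a w *: word w.
Proof.
move=> inj_io.
rewrite (partition_big (fun u : {ffun 'I_M -> 'I_N} => [ffun i => u (io i)]) xpredT) //=.
rewrite mulr_sumr; apply: eq_bigr => w _.
rewrite (eq_bigr (fun u => a w *: word u)); last by move=> u /eqP ->.
rewrite -scaler_sumr -scalerAr; congr (_ *: _).
(* A position [io i] must carry the letter [w i] and every other position is free, so the sum over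
   [u] factorizes over positions. *)
pose Q (j : 'I_M) (k : 'I_N) := [forall i, (io i == j) ==> (k == w i)].
rewrite (eq_bigl (fun u : {ffun 'I_M -> 'I_N} => u \in family Q)); last first.
  move=> u; apply/idP/familyP => [/eqP uw j|uQ].
    by apply/forallP => i; apply/implyP => /eqP <-; rewrite -uw ffunE.
  apply/eqP/ffunP => i; rewrite ffunE; have := uQ (io i).
  by move=> /forallP/(_ i); rewrite eqxx => /eqP.
rewrite /word -(bigA_distr_big_dep _ (fun (j : 'I_M) k => 'X_k : {mpoly R[N]})) /=.
rewrite (bigID (mem [set io i | i in 'I_D])) /= mulrC; congr (_ * _).
  rewrite (eq_bigr (fun=> \sum_i 'X_i)) => [|j jn].
    rewrite prodr_const; congr (_ ^+ _).
    rewrite -[RHS](_ : #|~: [set io i | i in 'I_D]| = _).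
      by apply: eq_card => j; rewrite !inE.
    by rewrite cardsCs finset.setCK card_ord card_imset // card_ord.
  apply: eq_bigl => k; apply/forallP => i; apply/implyP => /eqP ij.
  by case/negP: jn; rewrite -ij imset_f.
rewrite big_imset /=; last by move=> i j _ _; apply: inj_io.
apply: eq_bigr => i _; rewrite (big_pred1 (w i)) // => k.
apply/forallP/eqP => [/(_ i)|-> i']; first by rewrite eqxx => /eqP.
by apply/implyP => /eqP/inj_io ->.
Qed.

End Words.

(* Averaging over all maps [io], injective or not, gives the value of the form at
   the letter frequencies of [u], which is a point of the simplex. *)
Lemma meval_frequency (R : fieldType) (N D M : nat)
    (a : {ffun 'I_D -> 'I_N} -> R) (u : {ffun 'I_M -> 'I_N}) :
  (\sum_w a w *: word R w).@[fun k => (\sum_j (u j == k)%:R) / M%:R] =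
  (\sum_(io : {ffun 'I_D -> 'I_M}) a [ffun i => u (io i)]) / M%:R ^+ D.
Proof.
rewrite raddf_sum /= [in RHS](partition_big
  (fun io : {ffun 'I_D -> 'I_M} => [ffun i => u (io i)]) xpredT) //=.
rewrite mulr_suml; apply: eq_bigr => w _.
rewrite [in RHS](eq_bigr (fun=> a w)); last by move=> io /eqP ->.
rewrite mevalZ sumr_const -[a w *+ _]mulr_natr -[RHS]mulrA; congr (_ * _).
rewrite /word rmorph_prod /=.
under eq_bigr do rewrite mevalXU.
rewrite big_split /= prodr_const card_ord exprVn; congr (_ / _).
rewrite bigA_distr_bigA /= -sum1_card natr_sum [RHS]big_mkcond.
apply: eq_bigr => io _; rewrite -[io \in _]/([ffun i => u (io i)] == w).
case: eqP => [<-|ne]; first by rewrite big1 // => i _; rewrite ffunE eqxx.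
have [i ni] : exists i, u (io i) != w i.
  apply/existsP; apply: contra_notT ne => /existsPn H.
  by apply/ffunP => i; rewrite ffunE; apply/eqP; have := H i; rewrite negbK.
by rewrite (bigD1 i) //= (negbTE ni) mul0r.
Qed.

(** Each new point hits an earlier value with probability below D / M, so at most a share D^2 / M of
    the maps from D to M points is not injective. The factor M clears the denominator. *)
Lemma expn_ffact (M D : nat) : (M * M ^ D <= M * M ^_ D + D ^ 2 * M ^ D)%N.
Proof.
elim: D => [|D IH]; first by rewrite expn0 ffactn0; lia.
rewrite ffactnSr expnS.
have h1 : (M ^_ D <= M ^ D)%N.
  elim: D {IH} => [|D IH]; first by rewrite ffactn0 expn0.
  by rewrite ffactnSr expnSr leq_mul // leq_subr.
have [lMD|lDM] := leqP M D.
  by rewrite -[X in (X <= _)%N]mul1n; nia.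
nia.
Qed.

Definition simplex (R : realType) (N : nat) (t : 'rV[R]_N) : Prop :=
  (forall i, 0 <= t 0 i) /\ \sum_i t 0 i = 1.

(** Compactness of the simplex. The constraint [g] will be 0 for Polya's theorem and minus the
    lifted form for Reznick's. *)
Lemma simplex_lower_bound (R : realType) (N : nat) (f g : {mpoly R[N]}) :
  (forall t, simplex t -> 0 <= g.@[fun i => t 0 i] -> 0 < f.@[fun i => t 0 i]) ->
  exists2 mu, 0 < mu & forall t, simplex t -> 0 <= g.@[fun i => t 0 i] ->
    mu <= f.@[fun i => t 0 i].
Proof.
move=> fpos.
have [[t0 [t0S gt0]]|none] :=
    EM (exists t, simplex t /\ 0 <= g.@[fun i => t 0 i]); last first.
  by exists 1 => // t tS gt; case: none; exists t.
(* The booleans index the two opposite inequalities that encode the equation of the simplex. *)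
pose h (x : 'I_N + option bool) : {mpoly R[N]} :=
  match x with
  | inl i => 'X_i
  | inr None => g
  | inr (Some b) => (-1) ^+ b * (\sum_i 'X_i - 1)
  end.
have hE t : (simplex t /\ 0 <= g.@[fun i => t 0 i]) <->
    (forall i, `|t 0 i| <= 1) /\ forall x, 0 <= (h x).@[fun i => t 0 i].
  have sumE : (\sum_i 'X_i - 1 : {mpoly R[N]}).@[fun i => t 0 i] = \sum_i t 0 i - 1.
    rewrite mevalB meval1 raddf_sum /=; congr (_ - _).
    by apply: eq_bigr => i _; rewrite mevalXU.
  split=> [[[t_ge0 t_sum] gt]|[_ ht]].
    split=> [i|[i|[b|]]] //=; last 2 first.
    - by rewrite mevalXU.
    - by rewrite mevalM sumE t_sum subrr mulr0.
    by rewrite ger0_norm // -t_sum (bigD1 i) //= lerDl sumr_ge0.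
  split; last exact: (ht (inr None)).
  split=> [i|]; first by have := ht (inl i); rewrite /= mevalXU.
  have := ht (inr (Some true)); have := ht (inr (Some false)).
  by rewrite /= expr0 mul1r expr1 mulN1r mevalN sumE; lra.
have [|t /hE[tS gt] tmin] := @mpoly_attains_min R N _ h f.
  by exists t0; apply/hE.
exists f.@[fun i => t 0 i] => [|s sS gs]; first exact: fpos.
by apply: tmin; apply/hE.
Qed.

Theorem polya (R : realType) (N D : nat) (p : {mpoly R[N]}) :
  p \is D.-homog ->
  (forall t, simplex t -> 0 < p.@[fun i => t 0 i]) ->
  exists m, forall k, 0 <= ((\sum_i 'X_i) ^+ m * p)@_k.
Proof.
move=> /dhomog_words[a pE] p_gt0.
have [t tS _|mu mu_gt0 p_ge] := @simplex_lower_bound R N p 0; first exact: p_gt0.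
(* The coefficient of [word u] is the mean of [a] over the injective maps. It
   differs little from the mean over all maps, which is at least [mu]. *)
pose A := \sum_w `|a w|.
have a_le w : a w <= A.
  by rewrite (le_trans (ler_norm _)) // /A (bigD1 w) //= lerDl sumr_ge0.
have A_ge0 : 0 <= A by rewrite sumr_ge0.
(* As the non-injective maps have share at most D^2 / M, this [m] bounds their contribution to the
   mean by [mu]. *)
pose m := (Num.bound (A * (D ^ 2)%:R / mu)).+1.
exists m => k; set M := (m + D)%N.
have M_gt0 : (0 < M)%N by [].
have MR_gt0 : 0 < M%:R :> R by rewrite ltr0n.
have M_big : A * (D ^ 2)%:R <= M%:R * mu.
  rewrite -ler_pdivrMr // (le_trans (ltW (archi_boundP _))) //.
    by rewrite divr_ge0 ?mulr_ge0 // ltW.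
  by rewrite ler_nat (leq_trans (leqnSn _)) // leq_addr.
pose inj := [pred io : {ffun 'I_D -> 'I_M} | injectiveb io].
have card_inj : #|inj| = (M ^_ D)%N.
  by have := card_inj_ffuns 'I_D 'I_M; rewrite !card_ord => <-; apply: eq_card => x; rewrite !inE.
have inj_gt0 : 0 < #|inj|%:R :> R.
  by rewrite card_inj ltr0n ffact_gt0 leq_addl.
have c_ge0 (u : {ffun 'I_M -> 'I_N}) :
    0 <= \sum_(io in inj) a [ffun i => u (io i)].
  have freqS : simplex (\row_i ((\sum_j (u j == i)%:R) / M%:R : R)).
    split=> [i|]; first by rewrite mxE divr_ge0 ?ler0n // sumr_ge0.
    under eq_bigr do rewrite mxE.
    rewrite -mulr_suml exchange_big /= (eq_bigr (fun=> 1)) => [|j _].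
      by rewrite sumr_const card_ord divff // gt_eqF.
    rewrite (bigD1 (u j)) //= eqxx big1 ?addr0 // => i.
    by rewrite eq_sym => /negbTE ->.
  have := p_ge _ freqS; rewrite meval0 => /(_ (lexx _)).
  rewrite (meval_eq (v2 := fun i => (\sum_j (u j == i)%:R) / M%:R)); last first.
    by move=> i; rewrite mxE.
  rewrite pE meval_frequency ler_pdivlMr ?exprn_gt0 //.
  rewrite (bigID inj) /= => all_ge.
  have noninj_le : \sum_(io | ~~ inj io) a [ffun i => u (io i)] <=
      A * (M%:R ^+ D - (M ^_ D)%:R).
    rewrite (le_trans (ler_sum _ (fun io _ => a_le _))) // sumr_const.
    rewrite -[A *+ _]mulr_natr ler_wpM2l // lerBrDr -natrX -natrD ler_nat.
    have <- : #|{ffun 'I_D -> 'I_M}| = (M ^ D)%N by rewrite card_ffun !card_ord.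
    by rewrite -[X in (_ <= X)%N](cardC inj) -card_inj addnC leq_add2l.
  have := expn_ffact M D; rewrite -(ler_nat R) natrD !natrM natrX => count.
  rewrite -(pmulr_rge0 _ MR_gt0).
  have : 0 <= M%:R ^+ D :> R by rewrite exprn_ge0.
  nra.
(* By [sum_words_inj] every injective [io] yields the same polynomial, so adding them up averages
   the coefficients. *)
have sumE : ((\sum_i 'X_i) ^+ m * p) *+ #|inj| =
    \sum_(u : {ffun 'I_M -> 'I_N})
      (\sum_(io in inj) a [ffun i => u (io i)]) *: word R u.
  rewrite -sumr_const; under [RHS]eq_bigr do rewrite scaler_suml.
  rewrite exchange_big /=; apply: eq_bigr => io /injectiveP io_inj.
  by rewrite (sum_words_inj a io_inj) addnK -pE.
rewrite -(pmulr_lge0 _ inj_gt0) mulr_natr -mcoeffMn sumE raddf_sum /=.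
apply: sumr_ge0 => u _; rewrite mcoeffZ mulr_ge0 //.
by rewrite /word mprodXE mcoeffX ler0n.
Qed.

(** * Sums of squares of forms *)

Section SumsOfSquares.
Variables (R : realType) (n : nat).
Implicit Types (p q : {mpoly R[n]}).
Local Notation sos := (@is_sos_of_forms R n).

Lemma is_formM p q : is_form p -> is_form q -> is_form (p * q).
Proof. by move=> [d hp] [e hq]; exists (d + e)%N; apply: dhomogM. Qed.

Lemma sos0 : sos 0.
Proof. by exists [::]; split=> //; rewrite big_nil. Qed.

Lemma sos_sqr p : is_form p -> sos (p ^+ 2).
Proof.
by move=> hp; exists [:: p]; split=> [h|]; rewrite ?big_seq1 // inE => /eqP ->.
Qed.

Lemma sosD p q : sos p -> sos q -> sos (p + q).
Proof.
move=> [s [hs ->]] [t [ht ->]]; exists (s ++ t); rewrite big_cat; split=> // h.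
by rewrite mem_cat => /orP[/hs|/ht].
Qed.

Lemma sos_sum (I : Type) (r : seq I) (P : pred I) (F : I -> {mpoly R[n]}) :
  (forall i, P i -> sos (F i)) -> sos (\sum_(i <- r | P i) F i).
Proof. by move=> hF; apply: big_ind => //; [exact: sos0|exact: sosD]. Qed.

Lemma sosM p q : sos p -> sos q -> sos (p * q).
Proof.
move=> [s [hs ->]] [t [ht ->]].
exists [seq a * b | a <- s, b <- t]; split.
  by move=> h /allpairsP[[a b] /= [/hs ha /ht hb ->]]; apply: is_formM.
rewrite big_allpairs_dep mulr_suml; apply: eq_bigr => a _.
by rewrite mulr_sumr; apply: eq_bigr => b _; rewrite exprMn.
Qed.

Lemma sosZ c p : 0 <= c -> sos p -> sos (c *: p).
Proof.
move=> c_ge0 hp; rewrite -mul_mpolyC -(sqr_sqrtr c_ge0) rmorphXn /=.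
apply: sosM hp; apply: sos_sqr; exists 0%N.
by rewrite -[_%:MP]mulr1 mul_mpolyC dhomogZ // dhomog1.
Qed.

Lemma sosX p k : sos p -> sos (p ^+ k).
Proof.
move=> hp; elim: k => [|k IH]; last by rewrite exprS; apply: sosM.
by rewrite expr0 -(expr1n _ 2); apply: sos_sqr; exists 0%N; apply: dhomog1.
Qed.

Lemma sos_prod (I : Type) (r : seq I) (F : I -> {mpoly R[n]}) :
  (forall i, sos (F i)) -> sos (\prod_(i <- r) F i).
Proof.
move=> hF; apply: big_ind => //; last exact: sosM.
(* The empty product 1 is obtained as [0 ^+ 0]. *)
by have := @sosX 0 0 sos0.
Qed.

Lemma sos_half p : sos (p *+ 2) -> sos p.
Proof.
move=> hp; have -> : p = 2^-1 *: (p *+ 2).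
  by rewrite -scaler_nat scalerA mulVf ?scale1r ?pnatr_eq0.
by apply: sosZ hp; rewrite invr_ge0.
Qed.

Definition sqnorm : {mpoly R[n]} := \sum_i 'X_i ^+ 2.

Lemma is_form_var i : is_form ('X_i : {mpoly R[n]}).
Proof. by exists 1%N; rewrite dhomogX /= mdeg1. Qed.

Lemma is_formD_var i j (c : R) : is_form ('X_i + c *: 'X_j : {mpoly R[n]}).
Proof. by exists 1%N; apply: dhomogD; rewrite ?dhomogZ // dhomogX /= mdeg1. Qed.

Lemma sos_sqnorm : sos sqnorm.
Proof. by apply: sos_sum => i _; apply: sos_sqr; apply: is_form_var. Qed.

Lemma dhomog_sqnorm k : sqnorm ^+ k \is k.*2.-homog.
Proof.
rewrite -mul2n; apply: dhomogMn; rewrite rpred_sum // => i _.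
by rewrite expr2 (dhomogM (d := 1) (e := 1)) // dhomogX /= mdeg1.
Qed.

Lemma sqnormE (x : 'I_n -> R) : sqnorm.@[x] = \sum_i x i ^+ 2.
Proof. by rewrite raddf_sum /=; apply: eq_bigr => i _; rewrite rmorphXn /= mevalXU. Qed.

(** The variables of a monomial of even degree can be grouped in pairs. *)
Lemma even_dhomog_ind (P : nat -> {mpoly R[n]} -> Prop) :
  (forall k, P k 0) -> (forall k p q, P k p -> P k q -> P k (p + q)) ->
  (forall k c p, P k p -> P k (c *: p)) -> P 0%N 1 ->
  (forall k i j p, P k p -> P k.+1 ('X_i * 'X_j * p)) ->
  forall k p, p \is k.*2.-homog -> P k p.
Proof.
move=> P0 PD PZ P1 PX k; apply: dhomog_ind => //; first exact: PD.
move=> c s; elim: k s c => [|k IH] s c.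
  by move/size0nil => ->; rewrite big_nil; apply: PZ.
case: s => [|i [|j s]] //= [sz]; rewrite !big_cons mulrA.
by apply: PZ; apply: PX; have := IH s 1 sz; rewrite scale1r.
Qed.

(** Twice this form is (x_i +- x_j)^2 + (sigma - x_i^2) + (sigma - x_j^2), also when i = j. *)
Lemma sos_sqnormD_mulXX i j (b : bool) :
  sos (sqnorm + (-1) ^+ b *: ('X_i * 'X_j)).
Proof.
have sq_le k : sos (sqnorm - 'X_k ^+ 2).
  rewrite /sqnorm (bigD1 k) //= addrAC subrr add0r.
  by apply: sos_sum => l _; apply: sos_sqr; apply: is_form_var.
apply: sos_half; rewrite (_ : _ *+ 2 = ('X_i + (-1) ^+ b *: 'X_j) ^+ 2 +
    ((sqnorm - 'X_i ^+ 2) + (sqnorm - 'X_j ^+ 2))).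
  by apply: sosD; [apply/sos_sqr/is_formD_var | apply: sosD].
by case: b; rewrite ?expr0 ?expr1 ?scale1r ?scaleN1r; ring.
Qed.

(** Bounding both p and -p makes the induction work: 2 (a c +- b d) = (a + b) (c +- d) + (a - b) (c
    -+ d), with a = sigma and b = x_i x_j. *)
Lemma dhomog_sos_bound k p : p \is k.*2.-homog ->
  exists2 C, 0 < C & sos (C *: sqnorm ^+ k + p).
Proof.
have sN k' : sos (sqnorm ^+ k') by apply: sosX; apply: sos_sqnorm.
have grow C C' k' q : C <= C' -> sos (C *: sqnorm ^+ k' + q) ->
    sos (C' *: sqnorm ^+ k' + q).
  move=> CC' hC; rewrite -(subrK C C') scalerDl -addrA; apply: sosD hC.
  by apply: sosZ => //; rewrite subr_ge0.
pose P k p := exists C, sos (C *: sqnorm ^+ k + p) /\ sos (C *: sqnorm ^+ k - p).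
move=> hp; have [C [hC _]] : P k p; last first.
  exists (`|C| + 1); first by rewrite ltr_wpDl.
  by apply: grow hC; rewrite (le_trans (ler_norm _)) // lerDl.
move: k p hp; apply: even_dhomog_ind.
- by move=> k; exists 0; rewrite scale0r subr0 addr0; split; apply: sos0.
- move=> k p q [C [hp hp']] [D [hq hq']]; exists (C + D).
  rewrite scalerDl opprD.
  by split; rewrite addrACA; apply: sosD.
- move=> k c p [C [hp hp']]; exists (`|c| * C); rewrite -scalerA.
  have [c_ge0|c_lt0] := lerP 0 c.
    by rewrite ger0_norm // -scalerBr -scalerDr; split; apply: sosZ.
  have -> : c *: p = - (- c *: p) by rewrite scaleNr opprK.
  rewrite ltr0_norm // opprK -scalerBr -scalerDr.
  by split; apply: sosZ; rewrite // oppr_ge0 ltW.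
- by exists 1; rewrite expr0 scale1r subrr; split;
    [apply: sosD; apply: (@sosX 0 0 sos0) | apply: sos0].
move=> k i j p [C [hp hp']]; exists C.
have := sos_sqnormD_mulXX i j false; have := sos_sqnormD_mulXX i j true.
rewrite expr0 expr1 scale1r scaleN1r exprS => hm hP.
split; apply: sos_half.
  rewrite (_ : _ *+ 2 = (sqnorm + 'X_i * 'X_j) * (C *: sqnorm ^+ k + p) +
     (sqnorm - 'X_i * 'X_j) * (C *: sqnorm ^+ k - p)).
    by apply: sosD; apply: sosM.
  by rewrite -!mul_mpolyC; ring.
rewrite (_ : _ *+ 2 = (sqnorm + 'X_i * 'X_j) * (C *: sqnorm ^+ k - p) +
   (sqnorm - 'X_i * 'X_j) * (C *: sqnorm ^+ k + p)).
  by apply: sosD; apply: sosM.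
by rewrite -!mul_mpolyC; ring.
Qed.

Lemma dhomog_meval k p (r : R) (x : 'I_n -> R) : p \is k.-homog ->
  p.@[fun i => r * x i] = r ^+ k * p.@[x].
Proof.
move: p; apply: dhomog_ind => [|p q hp hq|c s sz].
- by rewrite !meval0 mulr0.
- by rewrite !mevalD hp hq mulrDr.
rewrite !mevalZ mulrCA; congr (_ * _); rewrite !rmorph_prod /=.
under eq_bigr do rewrite mevalXU.
under [in RHS]eq_bigr do rewrite mevalXU.
by rewrite big_split /= big_const_seq count_predT sz iter_mulr_1.
Qed.

Lemma meval_bounded p : exists2 B, 0 <= B &
  forall x : 'I_n -> R, (forall i, `|x i| <= 1) -> `|p.@[x]| <= B.
Proof.
exists (\sum_(m <- msupp p) `|p@_m|) => [|x x_le1]; first by rewrite sumr_ge0.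
rewrite mevalE (le_trans (ler_norm_sum _ _ _)) // ler_sum // => m _.
rewrite normrM ler_piMr // normr_prod prodr_ile1 // => i _.
by rewrite normrX exprn_ge0 //= exprn_ile1.
Qed.

Lemma meval_row p (x : 'I_n -> R) : p.@[fun i => (\row_j x j) 0 i] = p.@[x].
Proof. by apply: meval_eq => i; rewrite mxE. Qed.

(** On the unit sphere p has a positive minimum and q is bounded; homogeneity carries the estimate
    to all nonzero points. *)
Lemma positive_definiteB k p q :
  p \is k.-homog -> q \is k.-homog -> positive_definite p ->
  exists2 e, 0 < e & positive_definite (p - e *: q).
Proof.
move=> hp hq ppos; have [B B_ge0 qB] := meval_bounded q.
have coord_le1 (x : 'rV[R]_n) : sqnorm.@[fun i => x 0 i] = 1 ->
    forall i, `|x 0 i| <= 1.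
  rewrite sqnormE => x1 i.
  rewrite -(@ler_pXn2r _ 2) ?nnegrE // expr1n real_normK ?num_real // -x1.
  by rewrite (bigD1 i) //= lerDl sumr_ge0 // => j _; rewrite sqr_ge0.
pose h (b : bool) : {mpoly R[n]} := (-1) ^+ b * (sqnorm - 1).
have hE (x : 'rV[R]_n) : sqnorm.@[fun i => x 0 i] = 1 <->
    (forall i, `|x 0 i| <= 1) /\ forall b, 0 <= (h b).@[fun i => x 0 i].
  split=> [x1|[_ hx]].
    split; first exact: coord_le1.
    by move=> b; rewrite mevalM mevalB x1 meval1 subrr mulr0.
  have := hx true; have := hx false.
  rewrite /h expr0 mul1r expr1 mulN1r mevalN mevalB meval1; lra.
have [mu mu_gt0 p_ge] : exists2 mu, 0 < mu & forall x : 'rV[R]_n,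
    sqnorm.@[fun i => x 0 i] = 1 -> mu <= p.@[fun i => x 0 i].
  (* With no variables the sphere is empty, and any bound will do. *)
  have [[x0 x01]|none] := EM (exists x : 'rV[R]_n, sqnorm.@[fun i => x 0 i] = 1).
    have [|t /hE t1 tmin] := @mpoly_attains_min R n _ h p.
      by exists x0; apply/hE.
    exists p.@[fun i => t 0 i] => [|s s1]; last by apply: tmin; apply/hE.
    apply: ppos; apply: contra_eq_neq t1 => ->.
    rewrite sqnormE big1 => [|i _]; last by rewrite mxE expr0n.
    by rewrite eq_sym oner_eq0.
  by exists 1 => // x x1; case: none; exists x.
exists (mu / (B + 1)) => [|x x_neq0]; first by rewrite divr_gt0 // ltr_wpDl.
pose r := Num.sqrt (sqnorm.@[fun i => x 0 i]).
have n_gt0 : 0 < sqnorm.@[fun i => x 0 i].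
  rewrite sqnormE lt_def sumr_ge0 ?andbT => [|i _]; last exact: sqr_ge0.
  apply: contra_neq x_neq0 => /eqP; rewrite psumr_eq0 => [/allP x0|i _]; last exact: sqr_ge0.
  apply/rowP => i; rewrite mxE; apply/eqP.
  by have := x0 i (mem_index_enum _); rewrite /= sqrf_eq0.
have r_gt0 : 0 < r by rewrite sqrtr_gt0.
pose y : 'rV[R]_n := \row_i (r^-1 * x 0 i).
have y1 : sqnorm.@[fun i => y 0 i] = 1.
  rewrite meval_row (dhomog_meval (k := 2)).
    by rewrite exprVn sqr_sqrtr ?mulVf ?gt_eqF // ltW.
  by have := dhomog_sqnorm 1; rewrite expr1.
have xE (q' : {mpoly R[n]}) : q' \is k.-homog ->
    q'.@[fun i => x 0 i] = r ^+ k * q'.@[fun i => y 0 i].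
  move=> hq'; rewrite -dhomog_meval //; apply: meval_eq => i.
  by rewrite mxE mulrA divff ?mul1r // gt_eqF.
rewrite mevalB mevalZ !xE // mulrCA -mulrBr mulr_gt0 ?exprn_gt0 // subr_gt0.
apply: lt_le_trans (p_ge _ y1).
rewrite mulrAC ltr_pdivrMr ?ltr_wpDl // ltr_pM2l //.
apply: le_lt_trans (ler_norm _) _; apply: le_lt_trans (qB _ (coord_le1 _ y1)) _.
by rewrite ltrDl.
Qed.

End SumsOfSquares.

(** * Reznick's theorem *)

Section Reznick.
Variables (R : realType) (n : nat).
Local Notation N := #|{: 'I_n.+1 * 'I_n.+1 * bool}|.
Local Notation sos := (@is_sos_of_forms R n.+1).
Local Notation sqnorm := (sqnorm R n.+1).

(** Diagonal pairs are kept for uniform indexing: they give 2 x_i and 0. *)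
Definition pair_form (y : 'I_n.+1 * 'I_n.+1 * bool) : {mpoly R[n.+1]} :=
  'X_y.1.1 + (-1) ^+ y.2 *: 'X_y.1.2.

Definition pair_squares : N.-tuple {mpoly R[n.+1]} :=
  [tuple pair_form (enum_val i) ^+ 2 | i < N].

Definition pair_var (i j : 'I_n.+1) b : {mpoly R[N]} := 'X_(enum_rank (i, j, b)).

(* The element that [pair_squares] maps to [x_i * x_j]. *)
Definition entry i j : {mpoly R[N]} :=
  4^-1 *: (pair_var i j false - pair_var i j true).

(* The factor [(\sum_l 'X_l) ^+ 2] makes both summands of degree 4; it is 1 on the
   simplex. *)
Definition relations : {mpoly R[N]} :=
  \sum_i \sum_j (pair_var i j false + pair_var i j true
                 - (entry i i + entry j j) *+ 2) ^+ 2 * (\sum_l 'X_l) ^+ 2 +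
  \sum_k \sum_i \sum_j (entry k k * entry i j - entry k i * entry k j) ^+ 2.

Lemma pair_var_comp i j b :
  pair_var i j b \mPo pair_squares = ('X_i + (-1) ^+ b *: 'X_j) ^+ 2.
Proof. by rewrite comp_mpolyXU -tnth_nth tnth_mktuple enum_rankK. Qed.

Lemma entry_comp i j : entry i j \mPo pair_squares = 'X_i * 'X_j.
Proof.
rewrite comp_mpolyZ rmorphB /= !pair_var_comp expr0 expr1 scale1r scaleN1r.
rewrite (_ : _ - _ = 4%:R *: ('X_i * 'X_j)); last by rewrite scaler_nat; ring.
by rewrite scalerA mulVf ?scale1r // pnatr_eq0.
Qed.

(** The two signs add up to 2 x_i^2 + 2 x_j^2, summed over all ordered pairs. This turns Polya's
    multiplier into a power of sigma. *)
Lemma sum_var_comp :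
  (\sum_l 'X_l) \mPo pair_squares = (n.+1 * 4)%:R *: sqnorm.
Proof.
rewrite rmorph_sum /= (reindex (@enum_rank _)) /=; last first.
  by exists enum_val => x _; rewrite (enum_rankK, enum_valK).
transitivity (\sum_(y : 'I_n.+1 * 'I_n.+1) (('X_y.1 ^+ 2 + 'X_y.2 ^+ 2) *+ 2 : {mpoly R[n.+1]})).
  rewrite (eq_bigr (fun y => 'X_(enum_rank (y.1, y.2)) \mPo pair_squares)); last by case.
  rewrite -(pair_bigA _ (fun y b => 'X_(enum_rank (y, b)) \mPo pair_squares)) /=.
  apply: eq_bigr => -[i j] _; rewrite big_bool /= !pair_var_comp.
  by rewrite expr0 expr1 scale1r scaleN1r; ring.
rewrite -(pair_bigA _ (fun i j => ('X_i ^+ 2 + 'X_j ^+ 2) *+ 2 : {mpoly R[n.+1]})) /=.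
under eq_bigr do rewrite sumrMnl big_split /= sumr_const card_ord.
rewrite sumrMnl big_split /= sumr_const card_ord sumrMnl -/sqnorm scaler_nat.
by rewrite -mulr2n -!mulrnA; congr (_ *+ _); lia.
Qed.

Lemma relations_comp : relations \mPo pair_squares = 0.
Proof.
rewrite rmorphD /= !rmorph_sum /= [X in X + _]big1 ?add0r => [|i _].
  apply: big1 => k _; rewrite rmorph_sum; apply: big1 => i _ /=.
  rewrite rmorph_sum; apply: big1 => j _ /=.
  by rewrite rmorphXn rmorphB !rmorphM /= !entry_comp; ring.
rewrite rmorph_sum; apply: big1 => j _ /=.
rewrite rmorphM rmorphXn rmorphB rmorphMn !rmorphD /= !entry_comp !pair_var_comp.
by rewrite expr0 expr1 scale1r scaleN1r; ring.
Qed.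

Lemma dhomog_pair_var i j b : pair_var i j b \is 1.-homog.
Proof. by rewrite dhomogX /= mdeg1. Qed.

Lemma dhomog_entry i j : entry i j \is 1.-homog.
Proof. by rewrite dhomogZ // rpredB // dhomog_pair_var. Qed.

Lemma dhomog_sum_var m : (\sum_(l < N) 'X_l : {mpoly R[N]}) ^+ m \is m.-homog.
Proof.
rewrite -{2}[m]mul1n; apply: dhomogMn; rewrite rpred_sum // => l _.
by rewrite dhomogX /= mdeg1.
Qed.

Lemma dhomog_relations : relations \is 4.-homog.
Proof.
rewrite rpredD //.
  rewrite rpred_sum // => i _; rewrite rpred_sum // => j _.
  apply: (dhomogM (d := 2) (e := 2)); last exact: dhomog_sum_var.
  rewrite -[2%N]mul1n; apply: dhomogMn.
  by rewrite rpredB ?rpredMn ?rpredD // ?dhomog_entry ?dhomog_pair_var.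
rewrite rpred_sum // => k _; rewrite rpred_sum // => i _; rewrite rpred_sum // => j _.
rewrite -[4%N]/(2 * 2)%N; apply: dhomogMn.
by rewrite rpredB // (dhomogM (d := 1) (e := 1)) ?dhomog_entry.
Qed.

(** Replace x_i x_j by [entry i j] throughout. The last clause constrains only the entries at t,
    which is what [relations_rank1] supplies. *)
Lemma dhomog_lift d (p : {mpoly R[n.+1]}) : p \is d.*2.-homog ->
  exists q : {mpoly R[N]}, [/\ q \is d.-homog, q \mPo pair_squares = p &
    forall t x, (forall i j, (entry i j).@[t] = x i * x j) -> q.@[t] = p.@[x]].
Proof.
move: d p; apply: even_dhomog_ind.
- move=> d; exists 0; split=> [||t x _]; first exact: dhomog0.
    by rewrite rmorph0.
  by rewrite !meval0.
- move=> d p p' [q [hq qE qx]] [q' [hq' qE' qx']]; exists (q + q').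
  split; [exact: dhomogD|by rewrite rmorphD /= qE qE'|move=> t x tx].
  by rewrite !mevalD (qx t x) // (qx' t x).
- move=> d c p [q [hq qE qx]]; exists (c *: q).
  split; [exact: dhomogZ|by rewrite comp_mpolyZ qE|move=> t x tx].
  by rewrite !mevalZ (qx t x).
- exists 1; split=> [||t x _]; first exact: dhomog1.
    by rewrite rmorph1.
  by rewrite !meval1.
move=> d i j p [q [hq qE qx]]; exists (entry i j * q); split.
- by apply: (dhomogM (d := 1)) => //; apply: dhomog_entry.
- by rewrite rmorphM /= entry_comp qE.
by move=> t x tx; rewrite !mevalM (qx t x) // tx !mevalXU.
Qed.

Local Notation ev t := (meval (fun l : 'I_N => (t : 'rV[R]_N) 0 l)).

(** The quadratic relations make the matrix of entries have rank one. Dividing row k by the square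
    root of a positive diagonal entry (k, k) gives x. *)
Lemma relations_rank1 (t : 'rV[R]_N) : simplex t ->
  ev t relations <= 0 ->
  exists2 x : 'rV[R]_n.+1, x != 0 &
    forall i j, ev t (entry i j) = x 0 i * x 0 j.
Proof.
move=> [t_ge0 t_sum].
have sumE : ev t (\sum_l 'X_l) = 1.
  by rewrite raddf_sum -t_sum; apply: eq_bigr => l _; rewrite /= mevalXU.
have sqr_sum0 (I : finType) (F : I -> R) : (forall x, 0 <= F x) ->
    \sum_x F x <= 0 -> forall x, F x <= 0.
  move=> F_ge0 F0 x; apply: le_trans F0.
  by rewrite (bigD1 x) //= lerDl sumr_ge0.
pose lin i j := ev t (pair_var i j false) + ev t (pair_var i j true)
                 - (ev t (entry i i) + ev t (entry j j)) *+ 2.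
pose quad k i j := ev t (entry k k) * ev t (entry i j) - ev t (entry k i) * ev t (entry k j).
have -> : ev t relations = \sum_i \sum_j lin i j ^+ 2 +
    \sum_k \sum_i \sum_j quad k i j ^+ 2.
  rewrite rmorphD !rmorph_sum /=; congr (_ + _); apply: eq_bigr => i _.
    rewrite rmorph_sum; apply: eq_bigr => j _ /=.
    by rewrite rmorphM !rmorphXn rmorphB rmorphMn !rmorphD /= sumE expr1n mulr1.
  rewrite rmorph_sum; apply: eq_bigr => j _ /=; rewrite rmorph_sum.
  by apply: eq_bigr => k _ /=; rewrite rmorphXn rmorphB !rmorphM.
move=> rel0.
have lin_ge0 i : 0 <= \sum_j lin i j ^+ 2 by apply: sumr_ge0 => j _; exact: sqr_ge0.
have quad_ge0' k i : 0 <= \sum_j quad k i j ^+ 2 by apply: sumr_ge0 => j _; exact: sqr_ge0.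
have quad_ge0 k : 0 <= \sum_i \sum_j quad k i j ^+ 2 by apply: sumr_ge0 => i _.
have lins_ge0 : 0 <= \sum_i \sum_j lin i j ^+ 2 by apply: sumr_ge0 => i _.
have quads_ge0 : 0 <= \sum_k \sum_i \sum_j quad k i j ^+ 2 by apply: sumr_ge0 => i _.
have lin0 i j : lin i j = 0.
  apply/eqP; rewrite -sqrf_eq0 eq_le sqr_ge0 andbT.
  apply: (sqr_sum0 _ (fun j => lin i j ^+ 2)) => [j'|]; first exact: sqr_ge0.
  by apply: (sqr_sum0 _ (fun i => \sum_j lin i j ^+ 2)) => //; lra.
have quad0 k i j : quad k i j = 0.
  apply/eqP; rewrite -sqrf_eq0 eq_le sqr_ge0 andbT.
  apply: (sqr_sum0 _ (fun j => quad k i j ^+ 2)) => [j'|]; first exact: sqr_ge0.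
  apply: (sqr_sum0 _ (fun i => \sum_j quad k i j ^+ 2)) => //.
  by apply: (sqr_sum0 _ (fun k => \sum_i \sum_j quad k i j ^+ 2)) => //; lra.
have var_ge0 i j b : 0 <= ev t (pair_var i j b) by rewrite mevalXU.
have entryE i j : ev t (entry i j) = 4^-1 * (ev t (pair_var i j false) - ev t (pair_var i j true)).
  by rewrite mevalZ mevalB.
(* The linear relation at (i, i) forces the coordinate standing for (x_i - x_i)^2 to vanish. *)
have diag_ge0 i : 0 <= ev t (entry i i).
  have := lin0 i i; rewrite /lin !entryE.
  have := var_ge0 i i true; have := var_ge0 i i false; lra.
(* With a zero diagonal, the linear relations would make sums of two nonnegative coordinates vanish,
   hence t = 0. *)
have [k k_neq0] : exists k, ev t (entry k k) != 0.
  apply/existsP; apply: contraT => /existsPn diag0.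
  have var0 i j b : ev t (pair_var i j b) = 0.
    have := lin0 i j; rewrite /lin.
    have /negPn/eqP -> := diag0 i; have /negPn/eqP -> := diag0 j.
    have := var_ge0 i j true; have := var_ge0 i j false; case: b; lra.
  move: t_sum; rewrite big1 => [/esym/eqP|l _]; first by rewrite oner_eq0.
  have := var0 (enum_val l).1.1 (enum_val l).1.2 (enum_val l).2.
  by rewrite mevalXU -!surjective_pairing enum_valK.
have k_gt0 : 0 < ev t (entry k k) by rewrite lt_def k_neq0 diag_ge0.
pose r := Num.sqrt (ev t (entry k k)).
have rr : r * r = ev t (entry k k) by rewrite -expr2 sqr_sqrtr.
have r_neq0 : r != 0 by rewrite gt_eqF // sqrtr_gt0.
exists (\row_i (ev t (entry k i) / r)).
  apply/eqP => /rowP/(_ k); rewrite !mxE -rr => /eqP.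
  by rewrite mulfK // (negbTE r_neq0).
move=> i j; rewrite !mxE mulrACA -invfM rr.
by apply: (mulfI k_neq0); rewrite mulrCA divff // mulr1; have := quad0 k i j; rewrite /quad; lra.
Qed.

Theorem reznick d (p : {mpoly R[n.+1]}) : p \is d.*2.-homog ->
  positive_definite p -> exists m, sos (sqnorm ^+ m * p).
Proof.
move=> hp ppos; have [q [hq qE qx]] := dhomog_lift hp.
(* If the relations held at t, then q(t) = p(x) > 0 for some x; so they fail uniformly where q <=
   0. *)
have [mu mu_gt0 rel_ge] : exists2 mu, 0 < mu & forall t : 'rV[R]_N, simplex t ->
    0 <= (- q).@[fun i => t 0 i] -> mu <= relations.@[fun i => t 0 i].
  apply: simplex_lower_bound => t tS; rewrite mevalN oppr_ge0 => q_le0.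
  rewrite ltNge; apply/negP => /(relations_rank1 tS)[x x_neq0 tx].
  by have := ppos x x_neq0; rewrite -(qx _ _ tx) ltNge q_le0.
have [B B_ge0 qB] := meval_bounded q.
have rel_ge0 t : simplex t -> 0 <= relations.@[fun i => t 0 i].
  move=> _; rewrite mevalD !raddf_sum /= addr_ge0 // sumr_ge0 // => i _.
    rewrite raddf_sum sumr_ge0 // => j _ /=; rewrite mevalM !rmorphXn /=.
    by rewrite mulr_ge0 // sqr_ge0.
  rewrite raddf_sum sumr_ge0 // => j _ /=; rewrite raddf_sum sumr_ge0 // => k _ /=.
  by rewrite rmorphXn sqr_ge0.
pose s : {mpoly R[N]} := \sum_l 'X_l.
(* Where q <= 0, the relations contribute at least B + 1, which outweighs q >= -B. *)
pose c := (B + 1) / mu.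
have c_ge0 : 0 <= c by rewrite divr_ge0 ?addr_ge0 // ltW.
(* The powers of [s], which is 1 on the simplex, equalize the degrees d and 4. *)
pose F := q * s ^+ 4 + c *: (relations * s ^+ d).
have hF : F \is (d + 4).-homog.
  apply: dhomogD; first by apply: dhomogM => //; apply: dhomog_sum_var.
  rewrite dhomogZ // addnC; apply: dhomogM; last exact: dhomog_sum_var.
  exact: dhomog_relations.
have [t tS|m r_ge0] := polya hF.
  have sE : s.@[fun i => t 0 i] = 1.
    by case: tS => _ <-; rewrite raddf_sum; apply: eq_bigr => l _; rewrite /= mevalXU.
  rewrite mevalD mevalZ !mevalM !rmorphXn /= sE !expr1n !mulr1.
  have [q_gt0|q_le0] := ltP 0 q.@[fun i => t 0 i].
    by rewrite ltr_wpDr // mulr_ge0 // rel_ge0.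
  have q_geB : - B <= q.@[fun i => t 0 i].
    suff /qB : forall i, `|t 0 i| <= 1 by rewrite ler_norml => /andP[].
    move=> i; case: tS => t_ge0 <-.
    by rewrite ger0_norm // (bigD1 i) //= lerDl sumr_ge0.
  have : B + 1 <= c * relations.@[fun i => t 0 i].
    rewrite -[leLHS](divfK (lt0r_neq0 mu_gt0)) ler_wpM2l //.
    by apply: rel_ge; rewrite // mevalN oppr_ge0.
  lra.
exists (m + 4)%N.
have : sos ((s ^+ m * F) \mPo pair_squares).
  rewrite comp_mpolyEX; apply: sos_sum => k _; apply: sosZ; first exact: r_ge0.
  rewrite comp_mpolyX; apply: sos_prod => l; apply: sosX.
  by rewrite tnth_mktuple; apply: sos_sqr; apply: is_formD_var.
rewrite rmorphM rmorphD /= comp_mpolyZ !rmorphM !rmorphXn /= relations_comp mul0r scaler0 addr0.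
rewrite qE sum_var_comp.
have : (n.+1 * 4)%:R != 0 :> R by rewrite pnatr_eq0.
have : 0 <= (n.+1 * 4)%:R :> R by rewrite ler0n.
move: (_%:R : R) => a a_ge0 a_neq0 hsos.
rewrite (_ : _ * p = (a ^+ (m + 4))^-1 *: ((a *: sqnorm) ^+ m * (p * (a *: sqnorm) ^+ 4))).
  by apply: sosZ hsos; rewrite invr_ge0 exprn_ge0.
rewrite mulrCA -exprD exprZn -scalerAr scalerA mulVf ?expf_neq0 // scale1r.
exact: mulrC.
Qed.

End Reznick.

(** * Positive definite forms *)

(** Bernoulli's inequality in the form x^k (1 + k (1 - x)) <= 1. *)
Lemma exists_expr_le (R : archiRealFieldType) (x y : R) :
  0 <= x -> x < 1 -> 0 < y -> exists k, x ^+ k <= y.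
Proof.
move=> x_ge0 x_lt1 y_gt0; have x1_gt0 : 0 < 1 - x by rewrite subr_gt0.
have bern k : x ^+ k * (1 + k%:R * (1 - x)) <= 1.
  elim: k => [|k IH]; first by rewrite expr0 mul0r addr0 mul1r.
  apply: le_trans IH; rewrite exprSr -mulrA ler_wpM2l ?exprn_ge0 //.
  have : 0 <= (k%:R + 1) * (1 - x) ^+ 2 by rewrite mulr_ge0 ?sqr_ge0 ?addr_ge0.
  rewrite -natr1; lra.
pose k := Num.bound (y * (1 - x))^-1; exists k.
have k_big : y^-1 <= k%:R * (1 - x).
  by rewrite -ler_pdivrMr // -invfM ltW // archi_boundP // invr_ge0 mulr_ge0 // ltW.
have q_gt0 : 0 < 1 + k%:R * (1 - x) by rewrite ltr_pwDl // mulr_ge0 // ltW.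
apply: (@le_trans _ _ (1 + k%:R * (1 - x))^-1).
  by rewrite -[leRHS]mul1r ler_pdivlMr.
rewrite -[leRHS]invrK lef_pV2 ?posrE ?invr_gt0 //.
by apply: le_trans k_big _; rewrite lerDr.
Qed.

Section PositiveDefinite.
Variables (R : realType) (n : nat).
Implicit Types (p q f g : {mpoly R[n.+1]}).
Local Notation sos := (@is_sos_of_forms R n.+1).
Local Notation sqnorm := (sqnorm R n.+1).

Lemma sosB_expr p q k : sos p -> sos q -> sos (p - q) -> sos (p ^+ k - q ^+ k).
Proof.
move=> hp hq hpq; rewrite subrXX; apply: sosM => //.
by apply: sos_sum => i _; apply: sosM; apply: sosX.
Qed.

(** In odd degree the values at (1, ..., 1) and at its negative have opposite signs. *)
Lemma positive_definite_degree_even d f : f \is d.-homog ->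
  positive_definite f -> ~~ odd d.
Proof.
move=> hf fpos; apply/negP => d_odd.
have x0 : const_mx 1 != 0 :> 'rV[R]_n.+1.
  by apply/eqP => /rowP/(_ 0); rewrite !mxE => /eqP; rewrite oner_eq0.
have := fpos _ x0; have := fpos (- const_mx 1); rewrite oppr_eq0 => /(_ x0).
rewrite (meval_eq (v2 := fun i => -1 * (const_mx 1 : 'rV[R]_n.+1) 0 i)) => [|i].
  by rewrite (dhomog_meval _ _ hf) -signr_odd d_odd expr1; lra.
by rewrite [in LHS]mxE mulN1r.
Qed.

Lemma sos_sqnormX k : sos (sqnorm ^+ k).
Proof. by apply: sosX; apply: sos_sqnorm. Qed.

Lemma reznick_all d f : f \is d.*2.-homog -> positive_definite f ->
  exists m0, forall m, (m0 <= m)%N -> sos (sqnorm ^+ m * f).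
Proof.
move=> hf fpos; have [m0 hm0] := reznick hf fpos.
exists m0 => m hm; rewrite -(subnK hm) exprD -mulrA.
by apply: sosM hm0; apply: sos_sqnormX.
Qed.

(** Reznick's theorem needs a power of sigma as multiplier; K P (K P - H) = H (K P - H) + (K P -
    H)^2 trades it for a power of G. Here P = G^i, H = sigma^(d i), K = c^i. *)
Lemma sos_bounded_quotient G d : sos G -> G \is d.*2.-homog -> (0 < d)%N ->
  positive_definite G ->
  exists c i0, 0 < c /\ forall i, (i0 <= i)%N ->
    sos (G ^+ i * (c ^+ i *: G ^+ i - sqnorm ^+ (d * i))).
Proof.
move=> hG dG d_gt0 Gpos.
have [e e_gt0 Gepos] := positive_definiteB dG (dhomog_sqnorm R n.+1 d) Gpos.
have [|m0 hm0] := @reznick_all d _ _ Gepos.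
  by rewrite rpredB // dhomogZ // dhomog_sqnorm.
pose c := e^-1; have c_gt0 : 0 < c by rewrite invr_gt0.
exists c, m0; split=> // i hi.
set P := G ^+ i; set H := sqnorm ^+ (d * i); set K := c ^+ i.
have K_gt0 : 0 < K by rewrite exprn_gt0.
(* [c * G - sqnorm ^+ d] divides [K * P - H] with a sum of squares as cofactor. *)
have hHKP : sos (H * (K *: P - H)).
  rewrite /H /K /P exprM -exprZn subrXX mulrA; apply: sosM.
    rewrite -exprM (_ : c *: G - _ = c *: (G - e *: sqnorm ^+ d)).
      rewrite -scalerAr; apply: sosZ; first exact: ltW.
      by apply: hm0; rewrite (leq_trans hi) // leq_pmull.
    by rewrite scalerBr scalerA mulVf ?scale1r // gt_eqF.
  apply: sos_sum => j _; apply: sosM; apply: sosX; last exact: sos_sqnormX.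
  by apply: sosZ => //; apply: ltW.
rewrite (_ : P * _ = K^-1 *: (H * (K *: P - H) + (K *: P - H) ^+ 2)).
  apply: sosZ; first by rewrite invr_ge0 ltW.
  apply: sosD => //; apply: sos_sqr; exists (d * i).*2.
  by rewrite rpredB ?dhomogZ ?dhomog_sqnorm // -muln2 mulnAC muln2; apply: dhomogMn.
rewrite (_ : H * _ + _ = K *: (P * (K *: P - H))); last first.
  by rewrite -!mul_mpolyC; ring.
by rewrite scalerA mulVf ?scale1r // gt_eqF.
Qed.

Lemma even_power_sos d e f g : f \is d.*2.-homog -> g \is e.-homog -> (0 < e)%N ->
  positive_definite f -> positive_definite g -> exists m, sos (f * g ^+ m.*2).
Proof.
move=> hf hg e_gt0 fpos gpos.
pose G := g ^+ 2.
have hG : sos G by apply: sos_sqr; exists e.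
have dG : G \is e.*2.-homog by rewrite -muln2; apply: dhomogMn.
have Gpos : positive_definite G.
  by move=> x x0; rewrite rmorphXn /= exprn_gt0 // gpos.
have [c [i0 [c_gt0 hPW]]] := sos_bounded_quotient hG dG e_gt0 Gpos.
have [eps eps_gt0 fe_pos] := positive_definiteB hf (dhomog_sqnorm R n.+1 d) fpos.
have [|m0 hm0] := @reznick_all d _ _ fe_pos.
  by rewrite rpredB // dhomogZ // dhomog_sqnorm.
have [C C_gt0 hC] := dhomog_sos_bound hf.
(* The exponent i serves both [hPW] and, since e i >= i, the multiplier in [hm0]. *)
pose i := maxn i0 m0; pose P := G ^+ i.
pose W := (c ^+ i)^-1 *: sqnorm ^+ (e * i).
have K_gt0 : 0 < c ^+ i by rewrite exprn_gt0.
have hP : sos P by apply: sosX.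
have hW : sos W by apply: sosZ; rewrite ?invr_ge0 ?ltW //; apply: sos_sqnormX.
have hPPW : sos (P * (P - W)).
  rewrite (_ : P - W = (c ^+ i)^-1 *: (c ^+ i *: P - sqnorm ^+ (e * i))).
    rewrite -scalerAr; apply: sosZ; first by rewrite invr_ge0 ltW.
    by apply: hPW; rewrite leq_maxl.
  by rewrite scalerBr scalerA mulVf ?scale1r // gt_eqF.
have hfW : sos ((f - eps *: sqnorm ^+ d) * W).
  rewrite -scalerAr mulrC; apply: sosZ; first by rewrite invr_ge0 ltW.
  by apply: hm0; rewrite (leq_trans (leq_maxr i0 m0)) // leq_pmull.
have [delta [delta_gt0 delta_le1 hWP]] :
    exists delta, [/\ 0 < delta, delta <= 1 & sos (W - delta *: P)].
  have dP : - P \is (e * i).*2.-homog.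
    by rewrite rpredN -muln2 mulnAC muln2; apply: dhomogMn.
  have [B' B'_gt0 hB'] := dhomog_sos_bound dP.
  (* The first term of [D] turns W into B' sigma^(e i); the added 1 ensures that delta = 1 / D is at
     most 1. *)
  pose D := B' * c ^+ i + 1.
  have D_gt0 : 0 < D by rewrite ltr_wpDl // mulr_ge0 // ltW.
  exists D^-1; split; first by rewrite invr_gt0.
    by rewrite invf_le1 // lerDr mulr_ge0 // ltW.
  rewrite (_ : _ - _ = D^-1 *: ((B' *: sqnorm ^+ (e * i) - P) + W)).
    by apply: sosZ; [rewrite invr_ge0 ltW | apply: sosD].
  rewrite (_ : _ + W = D *: W - P).
    by rewrite scalerBr scalerA mulVf ?scale1r // gt_eqF.
  rewrite addrAC; congr (_ - _); rewrite [in RHS]scalerDl scale1r scalerA.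
  by rewrite mulfK // gt_eqF.
(* In terms of w = W / P, the quotient B / A is 1 - w. *)
pose A := P ^+ 2; pose B := P * (P - W).
have hA : sos A by apply: sosX.
pose rho := 1 - delta; pose eta := eps / (eps + C).
have rho_ge0 : 0 <= rho by rewrite subr_ge0.
have eta_gt0 : 0 < eta by rewrite divr_gt0 // addr_gt0.
have [k rho_k] : exists k, rho ^+ k <= eta.
  by apply: exists_expr_le; rewrite // ltrBlDr ltrDl.
(* Cleared form of (1 - w)^k <= rho^k <= eta, from rho A - B = P (W - delta P). *)
have hAB : sos (eta *: A ^+ k - B ^+ k).
  rewrite (_ : _ - _ = (eta - rho ^+ k) *: A ^+ k + ((rho *: A) ^+ k - B ^+ k)).
    apply: sosD; first by apply: sosZ; [rewrite subr_ge0 | apply: sosX].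
    apply: sosB_expr => //; first exact: sosZ.
    rewrite (_ : _ - _ = P * (W - delta *: P)); first exact: sosM.
    by rewrite /A /B /rho scalerBl scale1r -!mul_mpolyC; ring.
  by rewrite exprZn scalerBl addrA subrK.
exists (i * (2 * k))%N; rewrite -muln2 mulnC exprM -/G exprM -/P exprM -/A.
(* The three-term expansion of f multiplied by A^k; [eta] is chosen so that (eps + C) eta = eps. *)
rewrite (_ : f * _ = (f - eps *: sqnorm ^+ d) * (A ^+ k - B ^+ k) +
   ((C *: sqnorm ^+ d + f) * B ^+ k +
    (eps + C) *: (sqnorm ^+ d * (eta *: A ^+ k - B ^+ k)))).
  apply: sosD.
    rewrite subrXX mulrA (_ : A - B = W * P); last by rewrite /A /B; ring.
    rewrite mulrA; apply: sosM; first exact: sosM.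
    by apply: sos_sum => j _; apply: sosM; apply: sosX.
  apply: sosD; first by apply: sosM => //; apply: sosX.
  apply: sosZ; first by rewrite addr_ge0 // ltW.
  by apply: sosM => //; apply: sos_sqnormX.
have etaE : (eps + C) * eta = eps by rewrite mulrCA divff ?mulr1 // gt_eqF // addr_gt0.
have -> : (eps + C) *: (sqnorm ^+ d * (eta *: A ^+ k - B ^+ k)) =
    eps *: (sqnorm ^+ d * A ^+ k) - (eps + C) *: (sqnorm ^+ d * B ^+ k).
  by rewrite mulrBr scalerBr -scalerAr scalerA etaE.
by rewrite scalerDl -!mul_mpolyC; ring.
Qed.

End PositiveDefinite.

Theorem mainTheorem5 (R : realType) (n d e : nat) (f g : {mpoly R[n.+1]})
    (hd : (0 < d)%N) (he : (0 < e)%N)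
    (hf : f \is d.-homog) (hg : g \is e.-homog)
    (fpos : positive_definite f) (gpos : positive_definite g) :
  exists m0 : nat, forall m : nat, (m0 <= m)%N -> is_sos_of_forms (f * g ^+ m).
Proof.
have half k (p : {mpoly R[n.+1]}) (hp : p \is k.-homog) (ppos : positive_definite p) :
    p \is k./2.*2.-homog.
  by have := odd_double_half k;
    rewrite (negbTE (positive_definite_degree_even hp ppos)) add0n => ->.
have fgpos : positive_definite (f * g).
  by move=> x x0; rewrite mevalM mulr_gt0 ?fpos ?gpos.
(* Even exponents come from f and odd ones from f g; further even powers of g are squares. *)
have [k fk] := even_power_sos (half _ _ hf fpos) hg he fpos gpos.
have [l gl] := even_power_sos (half _ _ (dhomogM hf hg) fgpos) hg he fgpos gpos.
exists (k.*2 + l.*2).+1 => m hm.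
pose r := m./2; have mE := odd_double_half m.
have sq j : is_sos_of_forms (g ^+ j.*2).
  rewrite -muln2 exprM; apply: sos_sqr; exists (e * j)%N; exact: dhomogMn.
case m_odd : (odd m) mE => mE.
  rewrite (_ : f * _ = f * g * g ^+ l.*2 * g ^+ (r - l).*2); first exact: sosM.
  by rewrite -!mulrA -exprD -exprS; congr (_ * _ ^+ _); rewrite /r; lia.
rewrite (_ : f * _ = f * g ^+ k.*2 * g ^+ (r - k).*2); first exact: sosM.
by rewrite -mulrA -exprD; congr (_ * _ ^+ _); rewrite /r; lia.
Qed.
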